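(* Let $A,B,\mu,\sigma_s^2>0$, $\xi\in(0,1)$, $\theta\in(0,1)$, let $\mathbf{h}\in\mathbb{C}^{1\times N_T}$ and $h_s\in\mathbb{C}$ be nonzero, and let $\rho_e^{\mathrm{opt}}\ge 0$ be a constant not depending on $P_{BS}$. Set $a=\mu(1-\theta)$ and $d=\frac{\theta\xi\|\mathbf{h}\|^2|h_s|^2}{(1-\theta)\sigma_s^2}$. Then, for the given $\theta$, the maximizer over $P_{BS}\ge 0$ of the social welfare utility $$U_{SW}(\theta,P_{BS})=\mu(1-\theta)\left[\log\left(1+\frac{\theta\xi P_{BS}\|\mathbf{h}\|^2|h_s|^2}{(1-\theta)\sigma_s^2}\right)-\log\left(1+\rho_e^{\mathrm{opt}}\right)\right]-\theta\left(AP_{BS}^2+BP_{BS}\right)$$ is $$P_{BS}^{\mathrm{opt}}=\left[\frac{-(2\theta A+dB\theta)+\sqrt{(2\theta A+dB\theta)^2-8\theta Ad(B\theta-ad)}}{4\theta Ad}\right]^{+}.$$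
   Context: $[x]^+=\max\{x,0\}$, $\log$ is the natural logarithm and $\|\cdot\|$ is the Euclidean norm. Interpretation: $U_{SW}$ is the gain from the secrecy throughput of a device transmitter (with its transmit power already set to the full harvested power $\frac{\theta\xi P_{BS}\|\mathbf{h}\|^2}{1-\theta}$ and the eavesdroppers' SNR threshold set to $\rho_e^{\mathrm{opt}}$, which for given $\theta$ does not depend on $P_{BS}$) minus the quadratic energy cost of the base station transmitting at power $P_{BS}$ during the time fraction $\theta$. *)

(* Defs.v *)
From HB Require Import structures.
From mathcomp Require Import all_boot all_order all_algebra.
From mathcomp Require Import all_classical all_reals all_analysis.
From mathcomp Require Import complex.

Set Implicit Arguments.
Unset Strict Implicit.
Unset Printing Implicit Defensive.

Import Order.TTheory GRing.Theory Num.Theory.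
Import numFieldNormedType.Exports.

Local Open Scope classical_set_scope.
Local Open Scope ring_scope.

(* The norm [`|z|] of [z : complex R] is an element of [complex R]; [normc z]
   is the modulus as an element of [R]. *)
Definition cmod (R : realType) (z : complex R) : R := ComplexField.Normc.normc z.

(* The library norm on matrices is the sup norm, hence an explicit
   Euclidean norm. *)
Definition enorm (R : realType) (n : nat) (h : 'rV[complex R]_n) : R :=
  Num.sqrt (\sum_(j < n) cmod (h ord0 j) ^+ 2).

Definition pospart (R : realType) (x : R) : R := Num.max x 0.

Definition argmax_on (R : realType) (D : set R) (f : R -> R) : set R :=
  [set x | D x /\ forall y, D y -> f y <= f x].

(* [sigma_s2] stands for the noise power sigma_s^2, and [rho] for
   rho_e^opt. *)
Definition U_SW (R : realType) (N : nat) (A B mu sigma_s2 xi : R)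
    (h : 'rV[complex R]_N) (h_s : complex R) (rho theta P : R) : R :=
  mu * (1 - theta) *
    (ln (1 + (theta * xi * P * enorm h ^+ 2 * cmod h_s ^+ 2)
               / ((1 - theta) * sigma_s2))
     - ln (1 + rho))
  - theta * (A * P ^+ 2 + B * P).

(* Main.v *)
(** The utility is [a ln(1 + dP) - theta (A P^2 + B P)] up to a constant,
    and [ln (1 + x) <= x] puts its logarithm below the tangent at [Q], so
    [U(P) - U(Q) <= g(Q) (P - Q) - theta A (P - Q)^2], where
    [g(P) = a d / (1 + d P) - theta (2 A P + B)] is the derivative of [U].
    Hence any [Q >= 0] satisfying the KKT conditions is the unique maximizer,
    and [(1 + d P) g(P) = 0] is a quadratic equation in [P] whose larger root,
    cut off at [0], satisfies them. *)
Require Import Defs.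
From HB Require Import structures.
From mathcomp Require Import all_boot all_order all_algebra.
From mathcomp Require Import all_classical all_reals all_analysis.
From mathcomp Require Import complex.
From mathcomp Require Import ring lra.
Import Order.TTheory GRing.Theory Num.Theory.
Import numFieldNormedType.Exports.
Local Open Scope classical_set_scope.
Local Open Scope ring_scope.

Lemma cmod_gt0 (R : realType) (z : complex R) : z <> 0 -> 0 < cmod z.
Proof.
move=> z0; rewrite lt_neqAle; apply/andP; split.
  by apply/eqP => /esym /ComplexField.Normc.eq0_normc.
by case: z {z0} => x y; exact: sqrtr_ge0.
Qed.

Lemma enorm_gt0 (R : realType) (n : nat) (h : 'rV[complex R]_n) :
  h <> 0 -> 0 < enorm h.
Proof.
move=> h0; rewrite sqrtr_gt0 lt_neqAle sumr_ge0 ?andbT; last first.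
  by move=> j _; exact: sqr_ge0.
apply/eqP => /esym /psumr_eq0P hs.
apply: h0; apply/rowP => j; rewrite mxE.
have [//|/eqP/cmod_gt0 hj] := eqVneq (h ord0 j) 0.
have /eqP := hs (fun j _ => sqr_ge0 _) j isT.
by rewrite sqrf_eq0 gt_eqF.
Qed.

(** By concavity: this is [ln (1 + t) <= t] at [t = y / x - 1]. *)
Lemma ln_tangent (R : realType) (x y : R) :
  0 < x -> 0 < y -> ln y <= ln x + (y - x) / x.
Proof.
move=> x0 y0.
have -> : (y - x) / x = y / x - 1 by field; rewrite gt_eqF.
rewrite -lerBlDl -ln_div ?posrE // -[X in ln X](subrKC 1).
by apply: le_ln1Dx; rewrite ltrBrDr addNr divr_gt0.
Qed.

(** The quadratic gap gives uniqueness: a second maximizer [y] would force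
    [c * (y - x) ^+ 2 <= 0]. *)
Lemma argmax_on_set1 (R : realType) (D : set R) (f : R -> R) (c x : R) :
  0 < c -> D x -> (forall y, D y -> f y <= f x - c * (y - x) ^+ 2) ->
  argmax_on D f = [set x].
Proof.
move=> c0 Dx fx; apply/seteqP; split => [y [Dy fy]|_ ->] /=.
  have := fx _ Dy; have := fy _ Dx => h1 h2.
  have : c * (y - x) ^+ 2 <= 0 by lra.
  rewrite pmulr_rle0 // => h3.
  by apply/eqP; rewrite -subr_eq0 -sqrf_eq0 eq_le h3 sqr_ge0.
split=> // y Dy; apply: (le_trans (fx _ Dy)).
by rewrite lerBlDr lerDl mulr_ge0 ?sqr_ge0 ?ltW.
Qed.

(** [slope] is the derivative at [x]; its two conditions are dual feasibility and complementary
    slackness for the constraint [0 <= P]. *)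
Lemma argmax_log_sub_quadratic (R : realType) (a d k p q x : R) :
  0 <= a -> 0 < d -> 0 < p -> 0 <= x ->
  let slope := a * d / (1 + d * x) - (2 * p * x + q) in
  slope <= 0 -> x * slope = 0 ->
  argmax_on [set P : R | 0 <= P]
    (fun P => a * (ln (1 + d * P) - k) - (p * P ^+ 2 + q * P)) = [set x].
Proof.
move=> a0 d0 p0 x0 slope sl0 xsl; apply: (@argmax_on_set1 _ _ _ p) => // y /= y0.
have dx : 0 < 1 + d * x by have := mulr_ge0 (ltW d0) x0; lra.
have dy : 0 < 1 + d * y by have := mulr_ge0 (ltW d0) y0; lra.
have := ler_wpM2l a0 (ln_tangent _ _ _ dx dy).
have -> : a * (ln (1 + d * x) + (1 + d * y - (1 + d * x)) / (1 + d * x)) =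
    a * ln (1 + d * x) + (a * d / (1 + d * x)) * (y - x) by ring.
have -> : a * d / (1 + d * x) = slope + (2 * p * x + q) by rewrite /slope; ring.
have : y * slope <= 0 by rewrite mulr_ge0_le0.
move: xsl; clearbody slope => xsl ysl H.
(* Complementary slackness removes [x * slope]; the quadratic gap then comes from [2 * p * x * (y -
   x) - p * (y ^+ 2 - x ^+ 2) = - p * (y - x) ^+ 2]. *)
have : (slope + (2 * p * x + q)) * (y - x) =
  y * slope - x * slope + (2 * p * x + q) * (y - x) by ring.
rewrite xsl subr0 => E; rewrite E in H.
lra.
Qed.

Lemma quadratic_root_formula (R : rcfType) (u v w : R) :
  u != 0 -> 0 <= v ^+ 2 - 4 * u * w ->
  let x := (- v + Num.sqrt (v ^+ 2 - 4 * u * w)) / (2 * u) in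
  u * x ^+ 2 + v * x + w = 0.
Proof.
move=> u0 D0 x.
have := sqr_sqrtr D0; rewrite {}/x; set s := Num.sqrt _ => hs.
(* Eliminating [w] in favour of [s] leaves a rational identity in [u], [v], [s]. *)
have -> : w = (v ^+ 2 - s ^+ 2) / (4 * u) by rewrite hs; field.
by field.
Qed.

Theorem mainTheorem4 (R : realType) (N : nat) (A B mu sigma_s2 xi theta : R)
    (h : 'rV[complex R]_N) (h_s : complex R) (rho : R)
    (A_gt0 : 0 < A) (B_gt0 : 0 < B) (mu_gt0 : 0 < mu)
    (sigma_s2_gt0 : 0 < sigma_s2)
    (xi_gt0 : 0 < xi) (xi_lt1 : xi < 1)
    (theta_gt0 : 0 < theta) (theta_lt1 : theta < 1)
    (h_neq0 : h <> 0) (h_s_neq0 : h_s <> 0) (rho_ge0 : 0 <= rho) :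
  let a := mu * (1 - theta) in
  let d := (theta * xi * enorm h ^+ 2 * cmod h_s ^+ 2)
             / ((1 - theta) * sigma_s2) in
  let P_opt := pospart
    ((- (2 * theta * A + d * B * theta)
      + Num.sqrt ((2 * theta * A + d * B * theta) ^+ 2
                  - 8 * theta * A * d * (B * theta - a * d)))
     / (4 * theta * A * d)) in
  argmax_on [set P : R | 0 <= P]
    (fun P => U_SW A B mu sigma_s2 xi h h_s rho theta P)
  = [set P_opt].
Proof.
move=> a d; cbv zeta.
have t1 : 0 < 1 - theta by rewrite subr_gt0.
have a0 : 0 < a by rewrite mulr_gt0.
have d0 : 0 < d.
  by rewrite divr_gt0 ?mulr_gt0 ?enorm_gt0 ?cmod_gt0.
have -> : (fun P => U_SW A B mu sigma_s2 xi h h_s rho theta P) =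
    (fun P => a * (ln (1 + d * P) - ln (1 + rho)) -
              (theta * A * P ^+ 2 + theta * B * P)).
  apply/funext => P; rewrite /U_SW.
  rewrite (_ : _ / _ = d * P); last by rewrite /d; ring.
  by rewrite /a; ring.
clearbody a d.
set v := 2 * theta * A + d * B * theta.
set D := v ^+ 2 - _.
set r := (- v + _) / _.
have tA : 0 < theta * A by rewrite mulr_gt0.
have u0 : 0 < 2 * theta * A * d by rewrite !mulr_gt0.
have D0 : 0 <= D.
  (* Flipping the sign of the cross term absorbs the part of [D] that could be negative. *)
  have -> : D = (2 * theta * A - d * B * theta) ^+ 2 +
                8 * (theta * A) * (a * d ^+ 2) by rewrite /D /v; ring.
  by rewrite addr_ge0 ?sqr_ge0 ?mulr_ge0 ?sqr_ge0 ?ltW.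
(* [D] is the discriminant of [(2 * theta * A * P + theta * B) * (1 + d * P) - a * d], the
   stationarity equation with its denominator cleared. *)
have DE : D = v ^+ 2 - 4 * (2 * theta * A * d) * (theta * B - a * d).
  by rewrite /D; ring.
have v0 : 0 < v by rewrite addr_gt0 ?mulr_gt0.
(* If [0 <= r], the slope vanishes at [r]; otherwise it is nonpositive at [0]. *)
have [r0|r0] := leP 0 r.
  have Pr : pospart r = r by rewrite /pospart max_l.
  have dr : 0 < 1 + d * r by have := mulr_ge0 (ltW d0) r0; lra.
  have rootr : 2 * theta * A * d * r ^+ 2 + v * r + (theta * B - a * d) = 0.
    rewrite DE in D0.
    have := @quadratic_root_formula _ _ _ _ (lt0r_neq0 u0) D0.
    by rewrite -DE -[2 * (2 * _ * _ * _)](_ : 4 * theta * A * d = _) //; ring.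
  have sl : a * d / (1 + d * r) - (2 * (theta * A) * r + theta * B) = 0.
    have -> : a * d = (2 * (theta * A) * r + theta * B) * (1 + d * r).
      by rewrite -[LHS]addr0 -rootr /v; ring.
    by rewrite mulfK ?gt_eqF // subrr.
  by rewrite Pr; apply: argmax_log_sub_quadratic; rewrite ?sl ?mulr0 // ltW.
have Pr : pospart r = 0 by rewrite /pospart max_r // ltW.
have sv : Num.sqrt D < v.
  move: r0; rewrite /r pmulr_llt0; last by rewrite invr_gt0 !mulr_gt0.
  lra.
(* A negative larger root means [D < v ^+ 2], so the constant coefficient of the quadratic is
   positive; its opposite is the slope at [0]. *)
have adB : a * d < theta * B.
  have : D < v ^+ 2.
    by rewrite -(sqr_sqrtr D0) ltr_pXn2r // nnegrE ?sqrtr_ge0 ?ltW.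
  by rewrite DE ltrBlDr ltrDl pmulr_rgt0 ?mulr_gt0 // subr_gt0.
rewrite Pr; apply: argmax_log_sub_quadratic; rewrite ?mul0r ?(ltW a0) //.
by rewrite !mulr0 addr0 divr1 add0r subr_le0 ltW.
Qed.
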